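(* Let $G$ be a finite group acting by isometries on a metric space $X$. Then $$c_2(X/G)\leq \Upsilon(G)\cdot c_2(X).$$
   Context: For a map $f\colon X\to Y$ of metric spaces, let $\alpha,\beta\in[0,\infty]$ be the largest and smallest constants (respectively) with $\alpha\, d_X(x,x')\le d_Y(f(x),f(x'))\le\beta\, d_X(x,x')$ for all $x,x'\in X$; the distortion of $f$ is $\kappa(f):=\beta/\alpha$, with $\kappa(f)=\infty$ if $\alpha=0$ or $\beta=\infty$. The Euclidean distortion $c_2(X)\in[1,\infty]$ is the infimum of all $c$ for which there exist a Hilbert space $H$ and a map $f\colon X\to H$ with $\kappa(f)=c$ (a one-point space is a degenerate case, for which $c_2$ is taken to be $1$). If a group $G$ acts by isometries on a metric space $X$ with closed orbits, the orbit space $X/G$ carries the quotient metric $d([x],[y])=\inf_{p\in[x],\,q\in[y]}d_X(p,q)$, where $[x]=G\cdot x$. The Euclidean contortion of a finite group $G$ is $\Upsilon(G):=\sup_{V}c_2(V/G)$, where $V$ ranges over all (equivalence classes of) finite-dimensional real orthogonal representations of $G$. *)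

(* Defs.v *)
From HB Require Import structures.
From mathcomp Require Import all_boot all_order all_algebra all_fingroup.
From mathcomp Require Import mxrepresentation.
From mathcomp Require Import all_classical reals ereal topology normedtype.
From mathcomp Require Import ring.

Set Implicit Arguments.
Unset Strict Implicit.
Unset Printing Implicit Defensive.

Import Order.TTheory GRing.Theory Num.Theory.
Import numFieldNormedType.Exports.

Local Open Scope classical_set_scope.
Local Open Scope ring_scope.

Section Distortion.
Context {R : realType} {X Y : Type}.
Variables (dX : X -> X -> R) (dY : Y -> Y -> R) (f : X -> Y).
Local Open Scope ereal_scope.

(* Both extrema are attained; with the library convention +oo * 0 = 0, the
   value +oo is admissible for lower_lip iff X has at most one point, and is
   always admissible for upper_lip. *)
Definition lower_lip : \bar R :=
  ereal_sup [set a | 0 <= a /\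
    forall x x', a * (dX x x')%:E <= (dY (f x) (f x'))%:E].

Definition upper_lip : \bar R :=
  ereal_inf [set b | 0 <= b /\
    forall x x', (dY (f x) (f x'))%:E <= b * (dX x x')%:E].

Definition distortion : \bar R :=
  if (lower_lip == 0) || (upper_lip == +oo) then +oo
  else upper_lip / lower_lip.

End Distortion.

(* {dot H for idfun} is the type of symmetric positive definite bilinear forms
   on the real vector space H. *)
Definition is_hilbert (R : realType) (H : completeNormedModType R) : Prop :=
  exists ip : {dot H for idfun}, forall u : H, ip u u = `|u| ^+ 2.

(* The conditional isolates the degenerate spaces with at most one point, on
   which the distortion of a map is upper_lip / lower_lip = 0 / +oo. *)
Definition c2 (R : realType) (X : metricType R) : \bar R :=
  if `[< forall x y : X, x = y >] then 1%E
  else ereal_inf [set c | exists (H : completeNormedModType R) (f : X -> H),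
    is_hilbert H /\
    c = distortion (@mdist R X) (fun u v : H => `|u - v|) f].

(* Library actions are right actions; a left action is turned into a right one
   with the same orbits by x.g := g^-1 x. *)
Definition isometric_action (R : realType) (G : finGroupType)
    (X : metricType R) (to : {action G &-> X}) : Prop :=
  forall (g : G) (x y : X), mdist (to x g) (to y g) = mdist x y.

Section OrbitSpace.
Context {R : realType} {G : finGroupType} {X : metricType R}.
Context {to : {action G &-> X}}.

(* The proof of isometricity is a parameter of the type because it is needed
   for the quotient metric to be a metric. *)
Definition orbit_space (hto : isometric_action to) : Type :=
  {A : set X | exists x, A = range (to x)}.

Variable hto : isometric_action to.

HB.instance Definition _ := gen_eqMixin (orbit_space hto).
HB.instance Definition _ := gen_choiceMixin (orbit_space hto).

Definition orbit_dist (A B : orbit_space hto) : R :=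
  inf [set mdist p q | p in sval A & q in sval B].

Lemma act_id x : to x 1%g = x.
Proof.
case: (to) => f [inj mor] /=; apply: (inj 1%g).
by rewrite -mor ?inE// mulg1.
Qed.

Lemma act_mul x (g h : G) : to x (g * h)%g = to (to x g) h.
Proof. by case: (to) => f [inj mor] /=; rewrite mor ?inE. Qed.

Lemma orbit_dist_le (A B : orbit_space hto) p q :
  sval A p -> sval B q -> orbit_dist A B <= mdist p q.
Proof.
move=> Ap Bq; apply: ge_inf; last by exists p => //; exists q.
by exists 0 => _ [a _ [b _ <-]]; exact: mdist_ge0.
Qed.

Lemma orbit_dist_attained (A B : orbit_space hto) :
  exists p q, [/\ sval A p, sval B q & orbit_dist A B = mdist p q].
Proof.
have [x Ax] := svalP A; have [y By] := svalP B.
pose F (i : G * G) := mdist (to x i.1) (to y i.2).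
have [i _ imin] := @Order.TotalTheory.arg_minP _ R _ (1%g, 1%g) xpredT F isT.
have Ai : sval A (to x i.1) by rewrite Ax; exists i.1.
have Bi : sval B (to y i.2) by rewrite By; exists i.2.
exists (to x i.1), (to y i.2); split => //.
apply/eqP; rewrite eq_le orbit_dist_le//=.
apply: lb_le_inf; first by exists (F i), (to x i.1) => //; exists (to y i.2).
move=> _ [p Ap [q Bq <-]]; move: Ap Bq; rewrite Ax By.
by move=> [g _ <-] [h _ <-]; exact: (imin (g, h)).
Qed.

Lemma orbit_act (A : orbit_space hto) p g : sval A p -> sval A (to p g).
Proof.
have [x ->] := svalP A.
by move=> [h _ <-]; exists (h * g)%g => //; rewrite act_mul.
Qed.

Lemma orbit_trans (A : orbit_space hto) p q :
  sval A p -> sval A q -> exists g, to p g = q.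
Proof.
have [x ->] := svalP A; move=> [g _ <-] [h _ <-].
by exists (g^-1 * h)%g; rewrite -act_mul mulKVg.
Qed.

Lemma orbit_eq (A B : orbit_space hto) p : sval A p -> sval B p -> A = B.
Proof.
move=> Ap Bp; suff AB : sval A = sval B.
  case: A B AB {Ap Bp} => A hA [B hB] /= AB.
  by subst B; congr exist; exact: Prop_irrelevance.
apply/seteqP; split => q hq.
- by have [g <-] := orbit_trans Ap hq; exact: orbit_act.
- by have [g <-] := orbit_trans Bp hq; exact: orbit_act.
Qed.

Lemma orbit_distxx A : orbit_dist A A = 0.
Proof.
have [p [q [Ap Aq dAE]]] := orbit_dist_attained A A.
apply/eqP; rewrite eq_le {2}dAE mdist_ge0 andbT.
by rewrite (le_trans (orbit_dist_le Ap Ap))// mdistxx.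
Qed.

Lemma orbit_dist_positivity A B : orbit_dist A B = 0 -> A = B.
Proof.
have [p [q [Ap Bq ->]]] := orbit_dist_attained A B.
by move/mdist_positivity => pq; apply: (orbit_eq Ap); rewrite pq.
Qed.

Lemma orbit_dist_sym A B : orbit_dist A B = orbit_dist B A.
Proof.
apply/eqP; rewrite eq_le; apply/andP; split.
- have [p [q [Bp Aq ->]]] := orbit_dist_attained B A.
  by rewrite metric_sym; exact: orbit_dist_le.
- have [p [q [Ap Bq ->]]] := orbit_dist_attained A B.
  by rewrite metric_sym; exact: orbit_dist_le.
Qed.

Lemma orbit_dist_triangle B A C :
  orbit_dist A C <= orbit_dist A B + orbit_dist B C.
Proof.
have [p [q [Ap Bq ->]]] := orbit_dist_attained A B.
have [q' [r [Bq' Cr ->]]] := orbit_dist_attained B C.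
have [g qE] := orbit_trans Bq' Bq.
rewrite -(hto g q' r) qE (le_trans _ (metric_triangle _ _ _))//.
by apply: orbit_dist_le => //; exact: orbit_act.
Qed.

HB.instance Definition _ := @isMetric.Build R (orbit_space hto) orbit_dist
  orbit_distxx orbit_dist_positivity orbit_dist_sym orbit_dist_triangle.

End OrbitSpace.

(* An alias of 'rV[R]_n carrying the Euclidean metric, since the library puts
   the sup norm on matrices. *)
Definition euclid (R : realType) (n : nat) : Type := 'rV[R]_n.

Section Euclid.
Context {R : realType} {n : nat}.

HB.instance Definition _ := Choice.copy (euclid R n) 'rV[R]_n.

Definition euclid_dist (u v : euclid R n) : R :=
  Num.sqrt (\sum_(i < n) (u ord0 i - v ord0 i) ^+ 2).

Lemma sum_sqr_ge0 (a : 'I_n -> R) : 0 <= \sum_i a i ^+ 2.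
Proof. by apply: sumr_ge0 => i _; exact: sqr_ge0. Qed.

Lemma sum_sqr_eq0 (a : 'I_n -> R) : \sum_i a i ^+ 2 = 0 -> forall i, a i = 0.
Proof.
move=> /eqP; rewrite psumr_eq0 => [/allP a0 i|i _]; last exact: sqr_ge0.
by have := a0 i (mem_index_enum i); rewrite sqrf_eq0 => /eqP.
Qed.

Lemma cauchy_sum (a b : 'I_n -> R) :
  (\sum_i a i * b i) ^+ 2 <= (\sum_i a i ^+ 2) * (\sum_i b i ^+ 2).
Proof.
set C := \sum_i _; set A := \sum_i _; set B := \sum_i _.
have A0 : 0 <= A by exact: sum_sqr_ge0.
have [Aeq0|Aneq0] := eqVneq A 0.
  rewrite /C big1 ?Aeq0 ?mul0r ?expr0n// => i _.
  by rewrite (sum_sqr_eq0 Aeq0) mul0r.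
have : 0 <= \sum_i (A * b i - C * a i) ^+ 2 by exact: sum_sqr_ge0.
have -> : \sum_i (A * b i - C * a i) ^+ 2 = A * (A * B - C ^+ 2).
  rewrite (eq_bigr (fun i => A ^+ 2 * b i ^+ 2 - A * C * 2 * (a i * b i)
    + C ^+ 2 * a i ^+ 2)); last by move=> i _; ring.
  by rewrite big_split sumrB -!mulr_sumr -/A -/B -/C /=; ring.
by rewrite pmulr_rge0 ?subr_ge0// lt_neqAle eq_sym Aneq0.
Qed.

Lemma euclid_distxx u : euclid_dist u u = 0.
Proof.
by rewrite /euclid_dist big1 ?sqrtr0// => i _; rewrite subrr expr0n.
Qed.

Lemma euclid_dist_positivity u v : euclid_dist u v = 0 -> u = v.
Proof.
move=> /eqP; rewrite sqrtr_eq0 => le0; apply/rowP => i; apply/eqP.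
rewrite -subr_eq0; apply/eqP.
apply: (@sum_sqr_eq0 (fun i => u ord0 i - v ord0 i)).
by apply/eqP; rewrite eq_le le0 sum_sqr_ge0.
Qed.

Lemma euclid_dist_sym u v : euclid_dist u v = euclid_dist v u.
Proof.
by congr Num.sqrt; apply: eq_bigr => i _; rewrite -sqrrN opprB.
Qed.

Lemma euclid_dist_triangle v u w :
  euclid_dist u w <= euclid_dist u v + euclid_dist v w.
Proof.
rewrite /euclid_dist.
pose a i := u ord0 i - v ord0 i; pose b i := v ord0 i - w ord0 i.
rewrite (eq_bigr (fun i => (a i + b i) ^+ 2)); last first.
  by move=> i _; rewrite /a /b addrA subrK.
set A := \sum_i (u ord0 i - v ord0 i) ^+ 2.
set B := \sum_i (v ord0 i - w ord0 i) ^+ 2.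
have A0 : 0 <= A by exact: sum_sqr_ge0.
have B0 : 0 <= B by exact: sum_sqr_ge0.
rewrite -[leRHS]ger0_norm ?addr_ge0 ?sqrtr_ge0// -sqrtr_sqr ler_wsqrtr//.
rewrite (eq_bigr (fun i => a i ^+ 2 + a i * b i *+ 2 + b i ^+ 2)); last first.
  by move=> i _; rewrite sqrrD.
rewrite !big_split/= -/A -/B sqrrD !sqr_sqrtr// lerD2r lerD2l.
rewrite -mulr2n lerMn2r/= -sqrtrM// (le_trans (ler_norm _))//.
by rewrite -sqrtr_sqr ler_wsqrtr// cauchy_sum.
Qed.

HB.instance Definition _ := @isMetric.Build R (euclid R n) euclid_dist
  euclid_distxx euclid_dist_positivity euclid_dist_sym euclid_dist_triangle.

Lemma euclid_distE (u v : euclid R n) : euclid_dist u v =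
  Num.sqrt (((u - v : 'rV[R]_n) *m (u - v : 'rV[R]_n)^T) ord0 ord0).
Proof.
by congr Num.sqrt; rewrite mxE; apply: eq_bigr => i _; rewrite !mxE expr2.
Qed.

End Euclid.

Section OrthogonalRepresentation.
Context {R : realType} {G : finGroupType} {n : nat}.
Variable rG : mx_representation R [set: G]%G n.

Definition orthogonal_repr : Prop :=
  forall g : G, rG g *m (rG g)^T = 1%:M.

Definition repr_fun (u : euclid R n) (g : G) : euclid R n :=
  (u : 'rV[R]_n) *m rG g.

Lemma repr_fun1 : repr_fun^~ 1%g =1 id.
Proof. by move=> u; rewrite /repr_fun repr_mx1 mulmx1. Qed.

Lemma repr_funM u : act_morph repr_fun u.
Proof. by move=> g h; rewrite /repr_fun repr_mxM ?inE// mulmxA. Qed.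

Definition repr_action : {action G &-> euclid R n} :=
  TotalAction repr_fun1 repr_funM.

Lemma orthogonal_isometric :
  orthogonal_repr -> isometric_action repr_action.
Proof.
move=> ortho g u v; rewrite /mdist/= !euclid_distE /repr_fun -mulmxBl.
by rewrite trmx_mul mulmxA -(mulmxA _ (rG g)) ortho mulmx1.
Qed.

End OrthogonalRepresentation.

(* Every finite-dimensional real orthogonal representation is equivalent to an
   orthogonal matrix representation on some R^n. *)
Definition contortion (R : realType) (G : finGroupType) : \bar R :=
  ereal_sup [set c | exists (n : nat) (rG : mx_representation R [set: G]%G n)
    (ho : orthogonal_repr rG),
    c = c2 (orbit_space (orthogonal_isometric ho))].

(* Main.v *)
Require Import Defs.
From HB Require Import structures.
From mathcomp Require Import all_boot all_order all_algebra all_fingroup.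
From mathcomp Require Import mxrepresentation.
From mathcomp Require Import all_classical reals ereal topology normedtype.
From mathcomp Require Import ring lra.

(** Let f : X -> H have distortion c. The map x |-> (f (x g))_g is equivariant
   into H^G, a multiple of the regular representation, and the induced map
   X/G -> H^G/G has distortion at most c. On finitely many orbits only a
   finite-dimensional subspace of H matters, so H^G may be replaced by an
   orthogonal representation on some R^N, whose quotient embeds into a Hilbert
   space with distortion at most the contortion of G. Hence every finite subset
   of X/G embeds with the desired distortion.

   To pass to all of X/G, the Gram kernels of these finite embeddings are
   bounded, so they converge pointwise along an ultrafilter on the finite
   subsets. The limit is a positive semidefinite kernel k, and X/G embeds into
   the reproducing kernel Hilbert space of k. The squared norm of this space is
   the convex conjugate f |-> sup_e (2 <e, f> - k(e, e)) of the quadratic form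
   of k on finite combinations e of points, and its inner product is recovered
   from Stewart's identity, which survives the passage to the supremum. *)

Set Implicit Arguments.
Unset Strict Implicit.
Unset Printing Implicit Defensive.

Import Order.TTheory GRing.Theory Num.Theory.
Import numFieldNormedType.Exports.

Local Open Scope classical_set_scope.
Local Open Scope ring_scope.

(** * Positive semidefinite kernels *)

Section LinearCombination.
Context {R : realType} {Y : Type}.
Implicit Types (e : seq (R * Y)) (f g : Y -> R).

(** A list of (coefficient, point) pairs stands for a finitely supported signed measure e, and this
    is the pairing <e, f>. Concatenation of lists serves as addition. *)
Definition lincomb e f : R := \sum_(p <- e) p.1 * f p.2.

Definition scalecomb (t : R) e := [seq (t * p.1, p.2) | p <- e].

Lemma lincomb_cat e e' f : lincomb (e ++ e') f = lincomb e f + lincomb e' f.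
Proof. by rewrite /lincomb big_cat. Qed.

Lemma lincomb_scale t e f : lincomb (scalecomb t e) f = t * lincomb e f.
Proof.
rewrite /lincomb big_map mulr_sumr; apply: eq_bigr => p _ /=.
by rewrite mulrA.
Qed.

Lemma lincombD e f g :
  lincomb e (fun y => f y + g y) = lincomb e f + lincomb e g.
Proof. by rewrite -big_split; apply: eq_bigr => p _; rewrite mulrDr. Qed.

Lemma lincombZ e t f : lincomb e (fun y => t * f y) = t * lincomb e f.
Proof. by rewrite mulr_sumr; apply: eq_bigr => p _; rewrite mulrCA. Qed.

Lemma lincomb1 t y f : lincomb [:: (t, y)] f = t * f y.
Proof. by rewrite /lincomb big_seq1. Qed.

Lemma exchange_lincomb e e' (K : Y -> Y -> R) :
  lincomb e (fun y => lincomb e' (K y)) =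
  lincomb e' (fun z => lincomb e (K^~ z)).
Proof.
rewrite /lincomb; under eq_bigr do rewrite mulr_sumr.
rewrite exchange_big; apply: eq_bigr => p _; rewrite mulr_sumr.
by apply: eq_bigr => r _; rewrite mulrCA.
Qed.

End LinearCombination.

Record psd_kernel (R : realType) (Y : Type) := PsdKernel {
  kernel :> Y -> Y -> R;
  kernel_sym : forall y z, kernel y z = kernel z y;
  kernel_ge0 : forall e, 0 <= lincomb e (fun y => lincomb e (kernel y)) }.

Section Kernel.
Context {R : realType} {Y : Type}.
Variable k : psd_kernel R Y.
Implicit Types (e : seq (R * Y)) (f g : Y -> R) (C t : R).

Definition kform e e' := lincomb e (fun y => lincomb e' (k y)).

Lemma kformC e e' : kform e e' = kform e' e.
Proof.
rewrite /kform exchange_lincomb; apply: eq_bigr => p _; congr (_ * _).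
by apply: eq_bigr => r _; rewrite kernel_sym.
Qed.

Lemma kform_catl e1 e2 e : kform (e1 ++ e2) e = kform e1 e + kform e2 e.
Proof. exact: lincomb_cat. Qed.

Lemma kform_scalel t e e' : kform (scalecomb t e) e' = t * kform e e'.
Proof. exact: lincomb_scale. Qed.

Lemma kform_catr e e1 e2 : kform e (e1 ++ e2) = kform e e1 + kform e e2.
Proof. by rewrite kformC kform_catl !(kformC e). Qed.

Lemma kform_scaler t e e' : kform e' (scalecomb t e) = t * kform e' e.
Proof. by rewrite kformC kform_scalel kformC. Qed.

Definition kformE := (kform_catl, kform_catr, kform_scalel, kform_scaler).

(* The least such C is the squared norm of f in the reproducing kernel Hilbert
   space of k. *)
Definition rkhs_bound f C := forall e, 2 * lincomb e f - kform e e <= C.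

Lemma rkhs_bound_ge0 f C : rkhs_bound f C -> 0 <= C.
Proof. by move=> /(_ [::]); rewrite /kform /lincomb !big_nil mulr0 subr0. Qed.

Lemma rkhs_boundZ f C t :
  rkhs_bound f C -> rkhs_bound (fun y => t * f y) (t ^+ 2 * C).
Proof.
move=> fC e; rewrite lincombZ; have [->|t0] := eqVneq t 0.
  by have := kernel_ge0 k e; rewrite -/(kform e e); lra.
have t2 : 0 < t ^+ 2 by rewrite exprn_even_gt0.
(* Testing [f] on e / t and multiplying by t^2 gives the bound for t f on e. *)
have /(ler_wpM2l (ltW t2)) := fC (scalecomb t^-1 e).
apply: le_trans; rewrite !kformE lincomb_scale.
by rewrite le_eqVlt; apply/orP; left; apply/eqP; field.
Qed.

(** Dual form of Stewart's identity. Test [f] on s (e + t e') and [g] on s (e - e') with s = 1 / (1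
    + t): the linear terms regroup as <e, f + t g> + t <e', f - g>, and the mixed quadratic terms
    k(e, e') cancel. *)
Lemma rkhs_bound_stewart f g A B t e e' : 0 < t ->
  rkhs_bound f A -> rkhs_bound g B ->
  (2 * lincomb e (fun y => f y + t * g y) - kform e e) +
    t * (2 * lincomb e' (fun y => f y - g y) - kform e' e') <=
  (1 + t) * (A + t * B).
Proof.
move=> t0 fA gB; set s := (1 + t)^-1.
have t1 : 0 < 1 + t by lra.
have HA := fA (scalecomb s (e ++ scalecomb t e')).
have HB := gB (scalecomb s (e ++ scalecomb (-1) e')).
have : (1 + t) * (2 * lincomb (scalecomb s (e ++ scalecomb t e')) f -
   kform (scalecomb s (e ++ scalecomb t e')) (scalecomb s (e ++ scalecomb t e'))
   + t * (2 * lincomb (scalecomb s (e ++ scalecomb (-1) e')) g -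
   kform (scalecomb s (e ++ scalecomb (-1) e'))
     (scalecomb s (e ++ scalecomb (-1) e')))) <= (1 + t) * (A + t * B).
  by rewrite ler_pM2l// lerD// ler_pM2l.
apply: le_trans; rewrite le_eqVlt; apply/orP; left; apply/eqP.
have -> : (fun y => f y - g y) = (fun y => f y + (-1) * g y).
  by apply/funext => y; rewrite mulN1r.
rewrite !lincombD !lincombZ !kformE !lincomb_scale !lincomb_cat !lincomb_scale.
rewrite (kformC e' e) /s; field; lra.
Qed.

(** Cauchy-Schwarz: along the multiples s e the bound is a quadratic inequality in s, to be used at
    the best s. *)
Lemma rkhs_bound_eval f C e :
  rkhs_bound f C -> lincomb e f ^+ 2 <= C * kform e e.
Proof.
move=> fC; have C0 := rkhs_bound_ge0 fC.
have H s : 2 * s * lincomb e f - s ^+ 2 * kform e e <= C.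
  have := fC (scalecomb s e); rewrite !kformE lincomb_scale.
  by apply: le_trans; rewrite le_eqVlt; apply/orP; left; apply/eqP; ring.
have [K0|K0] := eqVneq (kform e e) 0; last first.
  have Kp : 0 < kform e e by rewrite lt_neqAle eq_sym K0; exact: kernel_ge0.
  (* The maximiser of the quadratic in s. *)
  have /(ler_wpM2r (ltW Kp)) := H (lincomb e f / kform e e).
  apply: le_trans; rewrite le_eqVlt; apply/orP; left; apply/eqP; field.
  exact: K0.
have [->|L0] := eqVneq (lincomb e f) 0; first by rewrite K0 expr0n/= mulr0.
(* With k(e, e) = 0 the bound is linear in s, and this s would give C + 1 <= C. *)
have := H ((C + 1) / (2 * lincomb e f)); rewrite K0 mulr0 subr0.
have -> : 2 * ((C + 1) / (2 * lincomb e f)) * lincomb e f = C + 1 by field.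
by lra.
Qed.

(** This is positivity of the form on e' - e, expanded. *)
Lemma rkhs_bound_kfun e : rkhs_bound (fun z => lincomb e (k^~ z)) (kform e e).
Proof.
move=> e'; have := kernel_ge0 k (e' ++ scalecomb (-1) e).
rewrite -/(kform _ _) !kformE -exchange_lincomb -/(kform _ _) (kformC e' e).
by lra.
Qed.

Definition in_rkhs : {pred Y -> R} :=
  fun f => `[< exists C, rkhs_bound f C >].

Lemma in_rkhsP f : reflect (exists C, rkhs_bound f C) (f \in in_rkhs).
Proof. exact: asboolP. Qed.

Lemma in_rkhs_submod : submod_closed in_rkhs.
Proof.
split.
  apply/in_rkhsP; exists 0 => e; have := kernel_ge0 k e; rewrite -/(kform e e).
  by rewrite /lincomb big1 => [|p _]; [lra|rewrite mulr0].
move=> t f g /in_rkhsP[A fA] /in_rkhsP[B gB]; apply/in_rkhsP.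
(* Stewart's inequality with parameter 1 and an empty e', for which the difference term vanishes. *)
exists ((1 + 1) * (t ^+ 2 * A + 1 * B)) => e.
have := rkhs_bound_stewart e [::] ltr01 (rkhs_boundZ t fA) gB.
rewrite {2 3}/lincomb /kform /lincomb !big_nil mulr0 subr0 mulr0 addr0.
by under eq_bigr do rewrite mul1r.
Qed.

HB.instance Definition _ := GRing.isSubmodClosed.Build R (Y -> R) in_rkhs
  in_rkhs_submod.

Record rkhs := Rkhs { rkhs_fun :> Y -> R; _ : rkhs_fun \in in_rkhs }.

HB.instance Definition _ := [isSub for rkhs_fun].
HB.instance Definition _ := [Choice of rkhs by <:].
HB.instance Definition _ := [SubChoice_isSubLmodule of rkhs by <:].

End Kernel.

(** * Reproducing kernel Hilbert spaces *)

Section RkhsNorm.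
Context {R : realType} {Y : Type} {k : psd_kernel R Y}.
Local Notation rkhs := (@rkhs R Y k).
Implicit Types (f g h : rkhs) (t C : R).

Lemma rkhsP f : exists C, rkhs_bound k f C.
Proof. by case: f => f /= /in_rkhsP. Qed.

Lemma rkhs_ext f g : (forall y, f y = g y) -> f = g.
Proof. by move=> fg; apply: val_inj; apply/funext => y; exact: fg. Qed.

Lemma rkhsDE f g y : (f + g) y = f y + g y.
Proof. by []. Qed.

Lemma rkhsNE f y : (- f) y = - f y.
Proof. by []. Qed.

Definition rkhs_sq f : R := inf [set C | rkhs_bound k f C].

Lemma rkhs_sq_le f C : rkhs_bound k f C -> rkhs_sq f <= C.
Proof.
by move=> fC; apply: ge_inf => //; exists 0 => B /rkhs_bound_ge0.
Qed.

Lemma rkhs_sqP f : rkhs_bound k f (rkhs_sq f).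
Proof.
move=> e; apply: lb_le_inf; first by have [C fC] := rkhsP f; exists C.
by move=> C; apply.
Qed.

Lemma rkhs_sq_ge0 f : 0 <= rkhs_sq f.
Proof. exact: rkhs_bound_ge0 (rkhs_sqP f). Qed.

Lemma rkhs_sqZ t f : rkhs_sq (t *: f) = t ^+ 2 * rkhs_sq f.
Proof.
have le s g : rkhs_sq (s *: g) <= s ^+ 2 * rkhs_sq g.
  by apply: rkhs_sq_le; exact: rkhs_boundZ (rkhs_sqP g).
apply/eqP; rewrite eq_le le/=; have [->|t0] := eqVneq t 0.
  by rewrite expr0n mul0r rkhs_sq_ge0.
have t2 : 0 < t ^+ 2 by rewrite exprn_even_gt0.
have /(ler_wpM2l (ltW t2)) := le t^-1 (t *: f).
by rewrite scalerA mulVf// scale1r mulrA -exprMn divff// expr1n mul1r.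
Qed.

Lemma rkhs_sq0 : rkhs_sq 0 = 0.
Proof. by rewrite -(scale0r 0) rkhs_sqZ expr0n mul0r. Qed.

Lemma rkhs_sqN f : rkhs_sq (- f) = rkhs_sq f.
Proof. by rewrite -scaleN1r rkhs_sqZ sqrrN expr1n mul1r. Qed.

(** The test combinations e and e' of [rkhs_bound_stewart] vary independently, so the two terms on
    the left reach their suprema one after the other. *)
Lemma rkhs_stewart_le f g t : 0 < t ->
  rkhs_sq (f + t *: g) + t * rkhs_sq (f - g) <=
  (1 + t) * (rkhs_sq f + t * rkhs_sq g).
Proof.
move=> t0; rewrite -lerBrDr; apply: rkhs_sq_le => e.
rewrite lerBrDl -lerBrDr mulrC -ler_pdivlMr//; apply: rkhs_sq_le => e'.
rewrite ler_pdivlMr// mulrC lerBrDl.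
exact: rkhs_bound_stewart (rkhs_sqP f) (rkhs_sqP g).
Qed.

(* The linear change of variables (f, g) -> (f + t g, f - g) is an involution
   up to the factor 1 + t, so the previous inequality applies both ways. *)
Lemma rkhs_stewart f g t : 0 < t ->
  rkhs_sq (f + t *: g) + t * rkhs_sq (f - g) =
  (1 + t) * (rkhs_sq f + t * rkhs_sq g).
Proof.
move=> t0; apply/eqP; rewrite eq_le rkhs_stewart_le//=.
have := rkhs_stewart_le (f + t *: g) (f - g) t0.
have -> : f + t *: g + t *: (f - g) = (1 + t) *: f.
  by rewrite scalerBr scalerDl scale1r addrACA subrr addr0.
have -> : f + t *: g - (f - g) = (1 + t) *: g.
  by rewrite opprB scalerDl scale1r addrC addrA subrK.
rewrite !rkhs_sqZ.
have -> : (1 + t) ^+ 2 * rkhs_sq f + t * ((1 + t) ^+ 2 * rkhs_sq g) =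
  (1 + t) * ((1 + t) * (rkhs_sq f + t * rkhs_sq g)) by ring.
by rewrite ler_pM2l// addr_gt0.
Qed.

Lemma rkhs_parallelogram f g :
  rkhs_sq (f + g) + rkhs_sq (f - g) = 2 * (rkhs_sq f + rkhs_sq g).
Proof. by have := rkhs_stewart f g ltr01; rewrite scale1r !mul1r. Qed.

(** The Jordan-von Neumann step: a linear combination of four parallelogram identities, which makes
    [rkhs_dot] additive. *)
Lemma rkhs_sqD3 f g h :
  rkhs_sq (f + g + h) + rkhs_sq f + rkhs_sq g + rkhs_sq h =
  rkhs_sq (f + g) + rkhs_sq (g + h) + rkhs_sq (f + h).
Proof.
have := rkhs_parallelogram (f + g) h.
have := rkhs_parallelogram f (g - h).
have := rkhs_parallelogram (f + h) g.
have := rkhs_parallelogram g h.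
rewrite opprB !addrA (addrAC f h g).
move: (rkhs_sq (f + g + h)) (rkhs_sq (f + g - h)) (rkhs_sq (f + h - g)).
move: (rkhs_sq (f + g)) (rkhs_sq (f + h)) (rkhs_sq (g + h)) (rkhs_sq (g - h)).
by move: (rkhs_sq f) (rkhs_sq g) (rkhs_sq h) => *; lra.
Qed.

Definition rkhs_dot f g := (rkhs_sq (f + g) - rkhs_sq f - rkhs_sq g) / 2.

Lemma rkhs_dotC f g : rkhs_dot f g = rkhs_dot g f.
Proof. by rewrite /rkhs_dot [f + g]addrC addrAC. Qed.

Lemma rkhs_dotDr f g h : rkhs_dot f (g + h) = rkhs_dot f g + rkhs_dot f h.
Proof.
have := rkhs_sqD3 f g h; rewrite /rkhs_dot addrA.
move: (rkhs_sq (f + g + h)) (rkhs_sq (f + g)) (rkhs_sq (f + h)).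
move: (rkhs_sq (g + h)) (rkhs_sq f) (rkhs_sq g) (rkhs_sq h).
by move=> *; lra.
Qed.

Lemma rkhs_dotNr f g : rkhs_dot f (- g) = - rkhs_dot f g.
Proof.
have := rkhs_parallelogram f g; rewrite /rkhs_dot rkhs_sqN.
move: (rkhs_sq (f + g)) (rkhs_sq (f - g)).
by move: (rkhs_sq f) (rkhs_sq g) => *; lra.
Qed.

(** For t > 0, subtracting t times the parallelogram identity from Stewart's identity at t yields
    homogeneity for all positive reals at once; [rkhs_dotNr] covers negative t. *)
Lemma rkhs_dotZr t f g : rkhs_dot f (t *: g) = t * rkhs_dot f g.
Proof.
wlog t0 : t / 0 < t => [hw|].
  have [t0|t0|<-] := ltgtP 0 t; first exact: hw.
    rewrite -[t]opprK scaleNr rkhs_dotNr hw ?oppr_gt0//; ring.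
  by rewrite scale0r mul0r /rkhs_dot addr0 rkhs_sq0 subrr subr0 mul0r.
have := rkhs_stewart f g t0; have := rkhs_parallelogram f g.
move=> /(congr1 ( *%R t)); rewrite /rkhs_dot rkhs_sqZ.
move: (rkhs_sq (f + t *: g)) (rkhs_sq (f + g)) (rkhs_sq (f - g)).
by move: (rkhs_sq f) (rkhs_sq g) => *; lra.
Qed.

Lemma rkhs_dotxx f : rkhs_dot f f = rkhs_sq f.
Proof.
by rewrite /rkhs_dot -[f in X in X - _ - _]scale1r -scalerDl rkhs_sqZ; field.
Qed.

Lemma rkhs_eval_sq f y : f y ^+ 2 <= rkhs_sq f * k y y.
Proof.
have := rkhs_bound_eval [:: (1, y)] (rkhs_sqP f).
by rewrite /kform !lincomb1 !mul1r.
Qed.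

Lemma rkhs_sq_eq0 f : rkhs_sq f = 0 -> f = 0.
Proof.
move=> f0; apply: rkhs_ext => y; apply/eqP; rewrite -sqrf_eq0 eq_le sqr_ge0.
by have := rkhs_eval_sq f y; rewrite f0 mul0r andbT.
Qed.

Definition rkhs_norm f := Num.sqrt (rkhs_sq f).

Lemma rkhs_norm_sq f : rkhs_norm f ^+ 2 = rkhs_sq f.
Proof. by rewrite sqr_sqrtr// rkhs_sq_ge0. Qed.

Lemma rkhs_normZ t f : rkhs_norm (t *: f) = `|t| * rkhs_norm f.
Proof. by rewrite /rkhs_norm rkhs_sqZ sqrtrM ?sqr_ge0// sqrtr_sqr. Qed.

Lemma rkhs_norm_eq0 f : rkhs_norm f = 0 -> f = 0.
Proof.
by move=> f0; apply: rkhs_sq_eq0; rewrite -rkhs_norm_sq f0 expr0n.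
Qed.

Lemma rkhs_normD f g : rkhs_norm (f + g) <= rkhs_norm f + rkhs_norm g.
Proof.
have n0 (h : rkhs) : 0 <= rkhs_norm h by exact: sqrtr_ge0.
have [/rkhs_norm_eq0 ->|f0] := eqVneq (rkhs_norm f) 0.
  by rewrite add0r lerDr.
have [/rkhs_norm_eq0 ->|g0] := eqVneq (rkhs_norm g) 0.
  by rewrite addr0 lerDl.
have {}f0 : 0 < rkhs_norm f by rewrite lt_neqAle eq_sym f0 n0.
have {}g0 : 0 < rkhs_norm g by rewrite lt_neqAle eq_sym g0 n0.
rewrite -ler_sqr ?nnegrE ?addr_ge0// !rkhs_norm_sq.
(* With t = |g| / |f|, Stewart's identity for f and g / t has right-hand side (|f| + |g|)^2.
   Dropping its nonnegative difference term leaves the triangle inequality. *)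
have t0 : 0 < rkhs_norm g / rkhs_norm f by rewrite divr_gt0.
have := rkhs_stewart f ((rkhs_norm g / rkhs_norm f)^-1 *: g) t0.
rewrite scalerA divff ?gt_eqF// scale1r rkhs_sqZ => st.
have := mulr_ge0 (ltW t0)
  (rkhs_sq_ge0 (f - (rkhs_norm g / rkhs_norm f)^-1 *: g)).
rewrite -(lerDl (rkhs_sq (f + g))) st => /le_trans; apply.
rewrite -!rkhs_norm_sq le_eqVlt; apply/orP; left; apply/eqP; field.
by rewrite !gt_eqF.
Qed.

HB.instance Definition _ :=
  Lmodule_isNormed.Build R rkhs rkhs_normD rkhs_normZ rkhs_norm_eq0.

Lemma rkhs_normE f : `|f| = rkhs_norm f.
Proof. by []. Qed.

End RkhsNorm.

Lemma lincomb_cvg (R : realType) (Y T : Type) (F : set_system T) (FF : Filter F)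
    (u : T -> Y -> R) (l : Y -> R) e :
  (forall y, u x y @[x --> F] --> l y) ->
  lincomb e (u x) @[x --> F] --> lincomb e l.
Proof.
move=> ul; apply: cvg_big => [|p _]; first exact: add_continuous.
exact: cvgMl_tmp.
Qed.

(** * Completeness of the reproducing kernel Hilbert space *)

Section RkhsComplete.
Context {R : realType} {Y : Type} {k : psd_kernel R Y}.
Local Notation rkhs := (@rkhs R Y k).
Implicit Types (f g : rkhs).

Lemma rkhs_eval_le f y : `|f y| <= `|f| * Num.sqrt (k y y).
Proof.
rewrite -sqrtr_sqr rkhs_normE -sqrtrM ?rkhs_sq_ge0//.
by rewrite ler_wsqrtr// rkhs_eval_sq.
Qed.

(** Rewrites a norm estimate as inequalities that each involve finitely many values of [f], hence
    survive pointwise limits. *)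
Lemma rkhs_norm_le f (r : R) : 0 <= r ->
  (`|f| <= r) <-> rkhs_bound k f (r ^+ 2).
Proof.
move=> r0; rewrite rkhs_normE; split=> [fr e|/rkhs_sq_le fr].
  apply: le_trans (rkhs_sqP f e) _; rewrite -rkhs_norm_sq.
  by rewrite ler_sqr ?nnegrE// sqrtr_ge0.
by rewrite -[leRHS]ger0_norm// -sqrtr_sqr ler_wsqrtr.
Qed.

Section CauchyFilter.
Variables (F : set_system rkhs) (FF : ProperFilter F) (F_cauchy : cauchy F).

Let limit y : R := lim ((f : rkhs) y @[f --> F]).

(** Evaluation at y is Lipschitz with constant sqrt (k y y), so it sends a Cauchy filter to a Cauchy
    filter of reals. *)
Let cvg_limit y : (f : rkhs) y @[f --> F] --> limit y.
Proof.
apply: R_complete; apply/cauchy_exP => eps eps0.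
(* The added 1 keeps [c] positive when k y y = 0. *)
pose c := Num.sqrt (k y y) + 1.
have c0 : 0 < c by rewrite ltr_wpDl// sqrtr_ge0.
have /cauchyP /(_ (eps / c)) [|f Ff] := F_cauchy; first by rewrite divr_gt0.
exists (f y); suff : F [set g : rkhs | ball (f y) eps (g y)] by [].
apply: filterS Ff => g /=; rewrite -!ball_normE/= => fg.
rewrite -rkhsNE -rkhsDE (le_lt_trans (rkhs_eval_le _ _))//.
move: fg; rewrite ltr_pdivlMr//; apply: le_lt_trans.
by rewrite ler_wpM2l// lerDl.
Qed.

Let limit_bound (f : rkhs) (r : R) : 0 < r -> F (ball f r) ->
  rkhs_bound k (fun y => limit y - f y) (r ^+ 2).
Proof.
move=> r0 Ff e.
pose u (g : Y -> R) := 2 * lincomb e (fun y => g y - f y) - kform k e e.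
have ur : \forall g \near F, u (g : rkhs) <= r ^+ 2.
  apply: filterS Ff => g; rewrite -ball_normE /= distrC => /ltW.
  by move/(rkhs_norm_le _ (ltW r0)); apply.
have ul : u (g : rkhs) @[g --> F] --> u limit.
  apply: cvgB; last exact: cvg_cst.
  apply: cvgMl_tmp; apply: lincomb_cvg => y.
  by apply: cvgB; [exact: cvg_limit|exact: cvg_cst].
exact: (closed_cvg (fun x => x <= r ^+ 2) (@closed_le _ _) ur _ ul).
Qed.

Lemma rkhs_cauchy_cvg : cvg F.
Proof.
have /cauchyP F_ex := F_cauchy.
have [f0 Ff0] := F_ex 1 ltr01.
(* The limit differs from the centre [f0] of a unit ball of the filter by a function of norm at most
   1. *)
have limit_in : limit \in in_rkhs k.
  have -> : limit = (fun y => limit y - f0 y) + f0.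
    by apply/funext => y /=; rewrite fctE subrK.
  rewrite rpredD ?(valP f0)//; apply/in_rkhsP; exists (1 ^+ 2).
  exact: limit_bound.
pose l : rkhs := Rkhs limit_in.
apply/cvg_ex; exists l; apply/cvgrPdist_le => eps eps0.
have eps2 : 0 < eps / 2 by rewrite divr_gt0.
have [f Ff] := F_ex _ eps2.
have lf : `|l - f| <= eps / 2.
  by apply/rkhs_norm_le; [exact: ltW|exact: limit_bound].
near=> g; rewrite -(subrK f l) -addrA (le_trans (ler_normD _ _))//.
rewrite (splitr eps) lerD//.
have : ball f (eps / 2) g by near: g.
by rewrite -ball_normE /= => /ltW.
Unshelve. all: by end_near. Qed.

End CauchyFilter.

HB.instance Definition _ := Uniform_isComplete.Build rkhs rkhs_cauchy_cvg.

End RkhsComplete.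

Section RkhsHilbert.
Context {R : realType} {Y : Type} {k : psd_kernel R Y}.
Local Notation rkhs := (@rkhs R Y k).
Implicit Types (f g : rkhs).

Let dot_bilinear : bilinear_for
  (GRing.Scale.Law.clone _ _ ( *%R ) _) (GRing.Scale.Law.clone _ _ ( *%R ) _)
  (@rkhs_dot R Y k).
Proof.
split => [g|f] t x y /=.
  by rewrite rkhs_dotC rkhs_dotDr rkhs_dotZr !(rkhs_dotC g).
by rewrite rkhs_dotDr rkhs_dotZr.
Qed.

HB.instance Definition _ := bilinear_isBilinear.Build R rkhs rkhs R
  (GRing.Scale.Law.clone _ _ ( *%R ) _) (GRing.Scale.Law.clone _ _ ( *%R ) _)
  (@rkhs_dot R Y k) dot_bilinear.

Let dot_hermitian f g : rkhs_dot f g = (-1) ^+ false * idfun (rkhs_dot g f).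
Proof. by rewrite expr0 mul1r /= rkhs_dotC. Qed.

HB.instance Definition _ := isHermitianSesquilinear.Build R rkhs false idfun
  (@rkhs_dot R Y k) dot_hermitian.

Let dot_gt0 f : f != 0 -> 0 < rkhs_dot f f.
Proof.
rewrite rkhs_dotxx lt0r rkhs_sq_ge0 andbT.
by apply: contra => /eqP/rkhs_sq_eq0 ->.
Qed.

HB.instance Definition _ := isDotProduct.Build R rkhs (@rkhs_dot R Y k) dot_gt0.

Lemma rkhs_hilbert : is_hilbert rkhs.
Proof.
exists (@rkhs_dot R Y k : {dot rkhs for idfun}) => u /=.
by rewrite rkhs_dotxx rkhs_normE rkhs_norm_sq.
Qed.

Lemma rkhs_feature_subproof y : k y \in in_rkhs k.
Proof.
apply/in_rkhsP; exists (kform k [:: (1, y)] [:: (1, y)]).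
have := rkhs_bound_kfun k [:: (1, y)].
by under [X in rkhs_bound _ X]eq_fun do rewrite lincomb1 mul1r.
Qed.

Definition rkhs_feature y : rkhs := Rkhs (rkhs_feature_subproof y).

(** The difference of features is the function represented by e = [y] - [z], of squared norm k(e,
    e): [rkhs_bound_kfun] bounds it above, and testing on e itself bounds it below. *)
Lemma rkhs_feature_dist y z :
  `|rkhs_feature y - rkhs_feature z| ^+ 2 = k y y + k z z - 2 * k y z.
Proof.
rewrite rkhs_normE rkhs_norm_sq; set e := [:: (1, y); (-1, z)] : seq (R * Y).
have fE : rkhs_feature y - rkhs_feature z =
    (fun x => lincomb e (k^~ x)) :> (_ -> _).
  apply/funext => x; rewrite rkhsDE rkhsNE /lincomb big_cons big_seq1 /=.
  by rewrite mul1r mulN1r.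
have -> : k y y + k z z - 2 * k y z = kform k e e.
  rewrite /kform /lincomb !big_cons !big_nil /= !addr0 !mul1r !mulN1r.
  by rewrite (kernel_sym k z y); ring.
apply/eqP; rewrite eq_le; apply/andP; split.
  by apply: rkhs_sq_le; rewrite fE; exact: rkhs_bound_kfun.
have := rkhs_sqP (rkhs_feature y - rkhs_feature z) e.
by rewrite fE -exchange_lincomb -/(kform k e e); lra.
Qed.

End RkhsHilbert.

(** * Finite determinacy of Hilbert space embeddings *)

Section RealDot.
Context {R : realType} {H : lmodType R}.
Variable ip : {dot H for idfun}.
Implicit Types (u v w : H) (t : R).

Lemma dotC u v : ip u v = ip v u.
Proof. by rewrite hermC expr0 mul1r. Qed.

Lemma dotBl u v w : ip (u - v) w = ip u w - ip v w.
Proof. exact: linearBl. Qed.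

Lemma dotZl t u w : ip (t *: u) w = t * ip u w.
Proof. exact: linearZl_LR. Qed.

Lemma dotBr u v w : ip w (u - v) = ip w u - ip w v.
Proof. by rewrite !(dotC w) dotBl. Qed.

Lemma dotZr t u w : ip w (t *: u) = t * ip w u.
Proof. by rewrite !(dotC w) dotZl. Qed.

Lemma dot0l w : ip 0 w = 0.
Proof. by rewrite -(subrr w) dotBl subrr. Qed.

Lemma dot_suml (I : Type) (r : seq I) (F : I -> H) w :
  ip (\sum_(i <- r) F i) w = \sum_(i <- r) ip (F i) w.
Proof.
elim/big_rec2: _ => [|i x y _ <-]; first exact: dot0l.
exact: linearDl.
Qed.

Lemma dot_sumr (I : Type) (r : seq I) (F : I -> H) w :
  ip w (\sum_(i <- r) F i) = \sum_(i <- r) ip w (F i).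
Proof. by rewrite dotC dot_suml; under eq_bigr do rewrite dotC. Qed.

Lemma dot_ge0 u : 0 <= ip u u.
Proof.
have [->|u0] := eqVneq u 0; first by rewrite dot0l.
exact: ltW (neq0_dnorm_gt0 _ u0).
Qed.

(** Gram-Schmidt by recursion: split off the coordinate along the first vector [v] and recurse on
    the projections to its orthogonal complement. The coordinates are bare functions, so their
    behaviour at 0 is carried along; it is needed where [P v] = 0. *)
Lemma gram_coordinates (s : seq H) : exists l : seq (H -> R),
  (forall w, \sum_(c <- l) c 0 * c w = 0) /\
  {in s &, forall u w, \sum_(c <- l) c u * c w = ip u w}.
Proof.
(* Induction on the length, since the recursive call concerns projected vectors and not the tail
   itself. *)
elim: {s}(size s) {1 3}s (erefl (size s)) => [|n IH] [|v s]//=.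
  by move=> _; exists [::]; split=> // w; rewrite big_nil.
move=> [sn]; have [v0|v0] := eqVneq v 0.
  have [l [l0 ls]] := IH s sn; exists l; split=> // u w.
  rewrite !inE v0 => /predU1P[->|us] /predU1P[->|ws]; last exact: ls.
  - by rewrite l0 dot0l.
  - by rewrite l0 dot0l.
  - by under eq_bigr do rewrite mulrC; rewrite l0 dotC dot0l.
have vv : 0 < ip v v by exact: neq0_dnorm_gt0.
pose P u := u - (ip u v / ip v v) *: v.
have Pv : P v = 0 by rewrite /P divff ?gt_eqF// scale1r subrr.
have [|l [l0 ls]] := IH [seq P u | u <- s]; first by rewrite size_map.
pose c u := ip u v / Num.sqrt (ip v v).
have cE u w : c u * c w = ip u v * ip w v / ip v v.
  rewrite /c mulrACA -invfM -expr2 sqr_sqrtr//; exact: ltW.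
exists (c :: [seq d \o P | d <- l]).
have E u w : \sum_(d <- c :: [seq d \o P | d <- l]) d u * d w =
    ip u v * ip w v / ip v v + \sum_(d <- l) d (P u) * d (P w).
  by rewrite big_cons cE big_map.
split=> [w|u w].
  by rewrite E /P dot0l !mul0r scale0r subrr l0 addr0.
rewrite E !inE => /predU1P[->|us] /predU1P[->|ws].
- by rewrite Pv l0 addr0 mulfK// gt_eqF.
- by rewrite Pv l0 addr0 mulrAC divff ?gt_eqF// mul1r dotC.
- under eq_bigr do rewrite mulrC.
  by rewrite Pv l0 addr0 mulfK// gt_eqF.
- rewrite ls ?map_f// /P !dotBl !dotBr !dotZl !dotZr (dotC v w); field.
  by rewrite gt_eqF.
Qed.

Lemma dot_kernel_sym (Y : Type) (h : Y -> H) y z :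
  ip (h y) (h z) = ip (h z) (h y).
Proof. exact: dotC. Qed.

Lemma dot_kernel_ge0 (Y : Type) (h : Y -> H) e :
  0 <= lincomb e (fun y => lincomb e (fun z => ip (h y) (h z))).
Proof.
rewrite (_ : lincomb _ _ =
  ip (\sum_(p <- e) p.1 *: h p.2) (\sum_(p <- e) p.1 *: h p.2)) ?dot_ge0//.
rewrite dot_suml; apply: eq_bigr => p _; rewrite dotZl; congr (_ * _).
by rewrite dot_sumr; apply: eq_bigr => q _; rewrite dotZr.
Qed.

Definition dot_kernel (Y : Type) (h : Y -> H) : psd_kernel R Y :=
  PsdKernel (dot_kernel_sym h) (dot_kernel_ge0 h).

End RealDot.

(** * Limits of kernels along an ultrafilter *)

Section KernelLimit.
Context {R : realType} {Y : choiceType}.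
Variable k : seq Y -> psd_kernel R Y.
Hypothesis k_bounded :
  forall y, exists C (s0 : seq Y), forall s : seq Y,
    {subset s0 <= s} -> k s y y <= C.

(** Positivity on [y] + [z] and on [y] - [z]. *)
Lemma psd_kernel_le (k0 : psd_kernel R Y) y z :
  `|k0 y z| <= (k0 y y + k0 z z) / 2.
Proof.
have := kernel_ge0 k0 [:: (1, y); (1, z)].
have := kernel_ge0 k0 [:: (1, y); (-1, z)].
rewrite /lincomb !big_cons !big_nil /= (kernel_sym k0 z y) => p m.
by rewrite ler_norml; apply/andP; split; lra.
Qed.

Lemma seq_ultrafilter : exists2 U : set_system (seq Y), UltraFilter U &
  forall s0 : seq Y, U [set s : seq Y | {subset s0 <= s}].
Proof.
pose B (s0 : seq Y) := [set s : seq Y | {subset s0 <= s}].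
have BF : ProperFilter (filter_from setT B).
  apply: filter_from_proper; last by move=> s _; exists s => x.
  apply: filter_from_filter; first by exists [::].
  move=> s t _ _; exists (s ++ t) => // r str; split => x xs; apply: str.
    by rewrite mem_cat xs.
  by rewrite mem_cat xs orbT.
have [U [UU BU]] := ultraFilterLemma BF.
by exists U => // s0; apply: BU; exists s0.
Qed.

Lemma psd_kernel_limit : exists (k0 : psd_kernel R Y) (U : set_system (seq Y)),
  [/\ ProperFilter U, forall s0 : seq Y, U [set s : seq Y | {subset s0 <= s}] &
      forall y z, k s y z @[s --> U] --> k0 y z].
Proof.
have [U UU Us] := seq_ultrafilter.
have cvg_k y z : exists l : R, k s y z @[s --> U] --> l.
  have [C [sy yC]] := k_bounded y; have [D [sz zD]] := k_bounded z.
  pose M := (C + D) / 2.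
  have kM : U [set s | `[- M, M]%classic (k s y z)].
    apply: filterS (Us (sy ++ sz)) => s ss /=.
    rewrite in_itv /= -ler_norml (le_trans (psd_kernel_le _ _ _))//.
    rewrite ler_pM2r// lerD// ?yC ?zD// => x xs; apply: ss.
      by rewrite mem_cat xs.
    by rewrite mem_cat xs orbT.
  (* Compactness of [-M, M] gives a cluster point, which along an ultrafilter is a limit. *)
  have [l [_ lc]] := @segment_compact R (- M) M (k s y z @[s --> U]) _ kM.
  exists l => A Al.
  have [//|UA] := in_ultra_setVsetC [set s | A (k s y z)] UU.
  by have [x [nAx Ax]] := lc (~` A) A UA Al.
pose l y z := projT1 (cid (cvg_k y z)).
have kl y z : k s y z @[s --> U] --> l y z by exact: projT2 (cid (cvg_k y z)).
have l_sym y z : l y z = l z y.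
  apply: cvg_unique (kl y z) _ => //.
  rewrite (_ : (fun s => k s y z) = (fun s => k s z y)); first exact: kl.
  by apply/funext => s; exact: kernel_sym.
have l_ge0 e : 0 <= lincomb e (fun y => lincomb e (l y)).
  apply: (closed_cvg (fun x => 0 <= x) (@closed_ge _ _)
    (u_ := fun s => lincomb e (fun y => lincomb e (k s y))) (F := U)).
    by apply: nearW => s; exact: kernel_ge0.
  by apply: lincomb_cvg => y; apply: lincomb_cvg => z; exact: kl.
exists (PsdKernel l_sym l_ge0), U; split => //.
exact: ultra_proper.
Qed.

End KernelLimit.

(* A limit of the Gram kernels of the finite embeddings, taken along an
   ultrafilter on the finite subsets, is the Gram kernel of an embedding of the
   whole space. *)
Lemma hilbert_embedding_finitary (R : realType) (X : metricType R) (x0 : X)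
    (a : R) :
  (forall s : seq X, exists (H : completeNormedModType R) (h : X -> H),
    is_hilbert H /\ {in s &, forall x y,
      mdist x y <= `|h x - h y| <= a * mdist x y}) ->
  exists (H : completeNormedModType R) (h : X -> H), is_hilbert H /\
    forall x y, mdist x y <= `|h x - h y| <= a * mdist x y.
Proof.
move=> fin.
have /choice[k kP] : forall s : seq X, exists k : psd_kernel R X,
  {in s, forall x, x0 \in s -> k x x <= (a * mdist x x0) ^+ 2} /\
  {in s &, forall x y,
    mdist x y ^+ 2 <= k x x + k y y - 2 * k x y <= (a * mdist x y) ^+ 2}.
  move=> s; have [H [h [[ip ipE] hs]]] := fin s.
  have hsq x y : x \in s -> y \in s ->
      mdist x y ^+ 2 <= `|h x - h y| ^+ 2 <= (a * mdist x y) ^+ 2.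
    move=> xs ys; have /andP[l u] := hs x y xs ys.
    have m0 := mdist_ge0 x y.
    by rewrite !ler_sqr ?nnegrE ?l ?u ?(le_trans m0)// (le_trans _ u).
  (* Moving the image of [x0] to the origin keeps distances and bounds the diagonal independently of
     [s]. *)
  exists (dot_kernel ip (fun x => h x - h x0)); split => [x xs x0s|x y xs ys].
    by rewrite /= ipE; have /andP[] := hsq x x0 xs x0s.
  have := hsq x y xs ys; rewrite -ipE /=.
  have -> : h x - h y = (h x - h x0) - (h y - h x0).
    by rewrite opprB addrA subrK.
  move: (h x - h x0) (h y - h x0) => u v; rewrite dotBl !dotBr (dotC ip v u).
  rewrite (_ : ip u u + ip v v - 2 * ip u v =
    ip u u - ip u v - (ip u v - ip v v))//; ring.
have k_bounded x : exists C (s0 : seq X), forall s : seq X,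
    {subset s0 <= s} -> k s x x <= C.
  exists ((a * mdist x x0) ^+ 2), [:: x; x0] => s ss.
  by apply: (kP s).1; apply: ss; rewrite !inE eqxx ?orbT.
have [k0 [U [UF Us kU]]] := psd_kernel_limit k_bounded.
exists (rkhs k0), (rkhs_feature (k := k0)); split; first exact: rkhs_hilbert.
move=> x y.
have lim_k : k s x x + k s y y - 2 * k s x y @[s --> U] -->
    k0 x x + k0 y y - 2 * k0 x y.
  by apply: cvgB; [exact: cvgD|exact: cvgMl_tmp].
have near_k : U [set s | mdist x y ^+ 2 <= k s x x + k s y y - 2 * k s x y <=
    (a * mdist x y) ^+ 2].
  apply: filterS (Us [:: x; y]) => s ss.
  by apply: (kP s).2; apply: ss; rewrite !inE eqxx ?orbT.
have sq_le : mdist x y ^+ 2 <=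
    `|rkhs_feature x - rkhs_feature y : rkhs k0| ^+ 2 <=
    (a * mdist x y) ^+ 2.
  rewrite rkhs_feature_dist; apply/andP; split.
    apply: (closed_cvg (fun r => _ <= r) (@closed_ge _ _) _ _ lim_k).
    by apply: filterS near_k => s /andP[].
  apply: (closed_cvg (fun r => r <= _) (@closed_le _ _) _ _ lim_k).
  by apply: filterS near_k => s /andP[].
have m0 := mdist_ge0 x y.
(* The sign comes from an embedding of the two points alone. *)
have am0 : 0 <= a * mdist x y.
  have [H [h [_ hs]]] := fin [:: x; y].
  have /andP[l u] : mdist x y <= `|h x - h y| <= a * mdist x y.
    by apply: hs; rewrite !inE eqxx ?orbT.
  exact: le_trans m0 (le_trans l u).
by move: sq_le; rewrite !ler_sqr ?nnegrE.
Qed.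

(** * Distortion *)

Section DistortionBounds.
Context {R : realType} {X Y : Type}.
Variables (dX : X -> X -> R) (dY : Y -> Y -> R) (f : X -> Y).
Hypothesis dY_ge0 : forall y y', 0 <= dY y y'.
Variables (x0 x1 : X).
Hypothesis x01 : 0 < dX x0 x1.
Local Notation lower := (lower_lip dX dY f).
Local Notation upper := (upper_lip dX dY f).
(** The stretch at one pair of distinct points lies between the two Lipschitz constants, so the
    lower one is finite and the distortion is at least 1. *)
Let q := dY (f x0) (f x1) / dX x0 x1.

Lemma lower_lip_ge0 : (0 <= lower)%E.
Proof.
by apply: ereal_sup_ubound; split=> // x x'; rewrite mul0e lee_fin.
Qed.

Lemma upper_lip_ge0 : (0 <= upper)%E.
Proof. by apply: le_ereal_inf_tmp => b []. Qed.

Lemma lower_lip_le : (lower <= q%:E)%E.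
Proof.
apply: ge_ereal_sup => -[r [_ /(_ x0 x1)]|[_ /(_ x0 x1)]|[]//].
  by rewrite -EFinM !lee_fin ler_pdivlMr.
by rewrite gt0_mulye.
Qed.

Lemma le_upper_lip : (q%:E <= upper)%E.
Proof.
apply: le_ereal_inf_tmp => -[r [_ /(_ x0 x1)]|_|[]//]; last exact: leey.
by rewrite -EFinM !lee_fin ler_pdivrMr.
Qed.

Lemma lower_lip_fin : lower \is a fin_num.
Proof.
rewrite ge0_fin_numE ?lower_lip_ge0//.
exact: le_lt_trans lower_lip_le (ltry _).
Qed.

Lemma distortion_ge1 : (1 <= distortion dX dY f)%E.
Proof.
rewrite /distortion; case: ifPn => [_|]; first exact: leey.
rewrite negb_or => /andP[l0 uy].
have ufin : upper \is a fin_num.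
  by rewrite ge0_fin_numE ?upper_lip_ge0// lt_neqAle uy leey.
have := lower_lip_ge0; have := le_trans lower_lip_le le_upper_lip; move: l0.
rewrite -(fineK lower_lip_fin) -(fineK ufin) inver.
move: (fine lower) (fine upper) => l u; rewrite eqe lee_fin => l0 lu l_ge0.
rewrite (negbTE l0) -EFinM lee_fin ler_pdivlMr ?mul1r//.
by rewrite lt_neqAle eq_sym l0 -lee_fin.
Qed.

Lemma distortion_lt (a : R) : (distortion dX dY f < a%:E)%E ->
  exists2 p : R * R, 0 < p.1 /\ p.2 < a * p.1 &
    forall x x', p.1 * dX x x' <= dY (f x) (f x') <= p.2 * dX x x'.
Proof.
rewrite /distortion; case: ifPn => [_|]; first by rewrite ltNge leey.
rewrite negb_or => /andP[l0 uy].
have ufin : upper \is a fin_num.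
  by rewrite ge0_fin_numE ?upper_lip_ge0// lt_neqAle uy leey.
pose l := fine lower; pose u := fine upper.
have lE : lower = l%:E by rewrite fineK// lower_lip_fin.
have uE : upper = u%:E by rewrite fineK.
have l_gt0 : 0 < l by rewrite -lte_fin -lE lt_neqAle eq_sym l0 lower_lip_ge0.
have u_ge0 : 0 <= u by rewrite -lee_fin -uE upper_lip_ge0.
rewrite lE uE inver gt_eqF// -EFinM lte_fin ltr_pdivrMr// => ua.
have a_gt0 : 0 < a by rewrite -(pmulr_lgt0 _ l_gt0) (le_lt_trans u_ge0).
(* The strict inequality leaves room: first an admissible b < a l, then an admissible c > b / a. *)
have /ereal_inf_lt[b [b0 bP]] : (upper < (a * l)%:E)%E by rewrite uE lte_fin.
case: b b0 bP => [b||]//; rewrite lee_fin lte_fin => b0 bP ba.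
have /ereal_sup_gt[c [c0 cP]] : ((b / a)%:E < lower)%E.
  by rewrite lE lte_fin ltr_pdivrMr// mulrC.
case: c c0 cP => [c||]// c0 cP; last first.
  by have := cP x0 x1; rewrite gt0_mulye.
rewrite lte_fin ltr_pdivrMr// mulrC => bc.
exists (c, b) => /=; first split => //.
  by rewrite -(pmulr_rgt0 _ a_gt0) (le_lt_trans b0).
by move=> x x'; rewrite -!lee_fin !EFinM cP bP.
Qed.

Lemma distortion_le (a b : R) : 0 < a ->
  (forall x x', a * dX x x' <= dY (f x) (f x') <= b * dX x x') ->
  (distortion dX dY f <= (b / a)%:E)%E.
Proof.
move=> a0 fab.
have b0 : 0 <= b.
  have /andP[_ u] := fab x0 x1.
  by rewrite -(pmulr_lge0 _ x01) (le_trans _ u).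
have al : (a%:E <= lower)%E.
  apply: ereal_sup_ubound; split=> [|x x']; first by rewrite lee_fin ltW.
  by rewrite -EFinM lee_fin; have /andP[] := fab x x'.
have ub : (upper <= b%:E)%E.
  apply: ereal_inf_lbound; split=> [|x x']; first by rewrite lee_fin.
  by rewrite -EFinM lee_fin; have /andP[] := fab x x'.
have ufin : upper \is a fin_num.
  by rewrite ge0_fin_numE ?upper_lip_ge0// (le_lt_trans ub (ltry _)).
rewrite /distortion; have := upper_lip_ge0; move: al ub.
rewrite -(fineK lower_lip_fin) -(fineK ufin).
move: (fine lower) (fine upper) => l u; rewrite !lee_fin => al ub u0.
have l0 : 0 < l by exact: lt_le_trans al.
rewrite eqe gt_eqF//= inver gt_eqF// -EFinM lee_fin.
by rewrite ler_pM// ?invr_ge0 ?lef_pV2 ?posrE// ltW.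
Qed.

End DistortionBounds.

Section EuclideanDistortion.
Context {R : realType}.

Lemma c2_ge1 (X : metricType R) : (1 <= c2 X)%E.
Proof.
rewrite /c2; case: ifPn => [//|/asboolPn/existsNP[x /existsNP[y xy]]].
apply: le_ereal_inf_tmp => _ [H [f [_ ->]]].
apply: (@distortion_ge1 _ _ _ _ _ _ _ x y); last first.
  by rewrite mdist_gt0; exact/eqP.
by move=> u v; exact: normr_ge0.
Qed.

Lemma c2_lt (X : metricType R) (x y : X) (a : R) : x <> y ->
  (c2 X < a%:E)%E -> exists (H : completeNormedModType R)
    (f : X -> H) (p : R * R),
    [/\ is_hilbert H, 0 < p.1, p.2 < a * p.1 &
      forall x x', p.1 * mdist x x' <= `|f x - f x'| <= p.2 * mdist x x'].
Proof.
move=> xy; rewrite /c2 asboolF; last by move=> /(_ x y).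
move=> /ereal_inf_lt[_ [H [f [hH ->]]]].
have d0 : 0 < mdist x y by rewrite mdist_gt0; exact/eqP.
move=> /(distortion_lt (fun u v => normr_ge0 (u - v)) d0)[p [p1 p2] fp].
by exists H, f, p; split.
Qed.

Lemma c2_le (X : metricType R) (x y : X) (a : R) : x <> y ->
  (exists (H : completeNormedModType R) (f : X -> H), is_hilbert H /\
    forall x x', mdist x x' <= `|f x - f x'| <= a * mdist x x') ->
  (c2 X <= a%:E)%E.
Proof.
move=> xy [H [f [hH fa]]]; rewrite /c2 asboolF; last by move=> /(_ x y).
have d0 : 0 < mdist x y by rewrite mdist_gt0; exact/eqP.
have f1 x' x'' : 1 * mdist x' x'' <= `|f x' - f x''| <= a * mdist x' x''.
  by rewrite mul1r.
have := distortion_le (fun u v => normr_ge0 (u - v)) d0 ltr01 f1.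
rewrite divr1; apply: le_trans.
by apply: ereal_inf_lbound; exists H, f.
Qed.

End EuclideanDistortion.

(** * Multiples of the regular representation *)

Section MultipleOfRegularRepresentation.
Context {R : realType} {G : finGroupType} {n : nat}.
Local Notation I := (G * 'I_n)%type.
Local Notation N := #|{: I}|.

(** Left translation on the coordinates (g, k) of n copies of the regular representation,
    transported to ['I_N] by enumeration. *)
Definition regular_index (h : G) (j : 'I_N) : 'I_N :=
  enum_rank ((h * (enum_val j).1)%g, (enum_val j).2).

Lemma regular_index1 j : regular_index 1%g j = j.
Proof. by rewrite /regular_index mul1g -surjective_pairing enum_valK. Qed.

Lemma regular_indexM g h j :
  regular_index (g * h)%g j = regular_index g (regular_index h j).
Proof. by rewrite /regular_index enum_rankK /= mulgA. Qed.

Definition regular_mx (h : G) : 'M[R]_N :=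
  \matrix_(i, j) (i == regular_index h j)%:R.

Lemma mul_regular_mx m (A : 'M[R]_(m, N)) h :
  A *m regular_mx h = \matrix_(i, j) A i (regular_index h j).
Proof.
apply/matrixP => i j; rewrite !mxE (bigD1 (regular_index h j))//=.
rewrite mxE eqxx mulr1 big1 ?addr0// => l /negbTE lj.
by rewrite mxE lj mulr0.
Qed.

Lemma regular_mx_repr : mx_repr [set: G]%G regular_mx.
Proof.
split=> [|g h _ _].
  by apply/matrixP => i j; rewrite !mxE regular_index1.
by rewrite mul_regular_mx; apply/matrixP => i j; rewrite !mxE regular_indexM.
Qed.

Definition regular_multiple : mx_representation R [set: G]%G N :=
  MxRepresentation regular_mx_repr.

Lemma regular_multiple_orthogonal : orthogonal_repr regular_multiple.
Proof.
move=> g; have -> : (regular_multiple g)^T = regular_multiple g^-1%g.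
  apply/matrixP => i j; rewrite !mxE; congr (_%:R); congr nat_of_bool.
  apply/eqP/eqP => ->.
    by rewrite -regular_indexM mulVg regular_index1.
  by rewrite -regular_indexM mulgV regular_index1.
by rewrite -repr_mxM ?inE// mulgV repr_mx1.
Qed.

Definition regular_vector (F : G -> 'I_n -> R) : euclid R N :=
  \row_j F (enum_val j).1 (enum_val j).2.

Lemma regular_vector_act (F : G -> 'I_n -> R) h :
  repr_fun regular_multiple (regular_vector F) h =
  regular_vector (fun g => F (h * g)%g).
Proof.
rewrite /repr_fun /= mul_regular_mx; apply/rowP => j.
by rewrite !mxE /regular_index enum_rankK.
Qed.

Lemma regular_vector_dist (F F' : G -> 'I_n -> R) :
  mdist (regular_vector F) (regular_vector F') =
  Num.sqrt (\sum_g \sum_k (F g k - F' g k) ^+ 2).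
Proof.
congr Num.sqrt; rewrite pair_big /=.
rewrite (reindex_onto (@enum_val _ {: I}) enum_rank)/=; last first.
  by move=> i _; rewrite enum_rankK.
by apply: eq_big => [j|j _]; rewrite ?enum_valK ?eqxx// !mxE.
Qed.

End MultipleOfRegularRepresentation.
Arguments regular_multiple R G n : clear implicits.

(** * Equivariant lift of an embedding *)

Section EquivariantLift.
Context {R : realType} {G : finGroupType} {X : metricType R}.
Context {to : {action G &-> X}} (hto : isometric_action to).
Variables (H : completeNormedModType R) (f : X -> H) (a b : R).
Hypotheses (hH : is_hilbert H) (a_ge0 : 0 <= a) (b_ge0 : 0 <= b).
Hypothesis fab : forall x y, a * mdist x y <= `|f x - f y| <= b * mdist x y.

(** The lift has coordinates c_k (f (x g)), with c_k the Gram coordinates of the image of [s]. When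
    both orbits lie in [s], the squared distance is the sum over g of |f (x g) - f (y g)|^2; the
    action is isometric, so the bounds on the |G| terms agree, whence the factor sqrt |G|. *)
Lemma equivariant_lift (s : seq X) :
  exists n (F : X -> euclid R #|{: G * 'I_n}|),
  (forall x h, repr_action (regular_multiple R G n) (F x) h = F (to x h)) /\
  forall x y, (forall g, to x g \in s) -> (forall g, to y g \in s) ->
    Num.sqrt #|G|%:R * a * mdist x y <= mdist (F x) (F y) <=
    Num.sqrt #|G|%:R * b * mdist x y.
Proof.
have [ip ipE] := hH; have [l [_ ls]] := gram_coordinates ip [seq f x | x <- s].
pose c (k : 'I_(size l)) := nth (fun=> 0) l k.
exists (size l), (fun x => regular_vector (fun g k => c k (f (to x g)))).
split=> [x h|x y xs ys].
  rewrite /repr_action /= regular_vector_act; congr regular_vector.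
  by apply/funext => g; rewrite act_mul.
have -> : mdist (regular_vector (fun g k => c k (f (to x g))))
    (regular_vector (fun g k => c k (f (to y g)))) =
    Num.sqrt (\sum_(g : G) `|f (to x g) - f (to y g)| ^+ 2).
  rewrite regular_vector_dist; congr Num.sqrt; apply: eq_bigr => g _.
  have fx : f (to x g) \in [seq f x | x <- s] by apply: map_f.
  have fy : f (to y g) \in [seq f x | x <- s] by apply: map_f.
  (* The coordinates are controlled only through Gram entries of listed vectors, so both sides are
     expanded into these. *)
  rewrite -ipE dotBl !dotBr -!ls// -!sumrB (big_nth (fun=> 0)) big_mkord.
  by apply: eq_bigr => k _; rewrite /c; ring.
have sumC (t : R) : 0 <= t -> Num.sqrt #|G|%:R * t * mdist x y =
    Num.sqrt (\sum_(g : G) (t * mdist (to x g) (to y g)) ^+ 2).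
  move=> t0; under eq_bigr do rewrite hto.
  rewrite sumr_const -[in RHS]mulr_natl sqrtrM ?ler0n// sqrtr_sqr.
  rewrite ger0_norm ?mulrA//.
  by rewrite mulr_ge0// mdist_ge0.
have le_sq (u v : G -> R) : (forall g, 0 <= u g <= v g) ->
    Num.sqrt (\sum_g u g ^+ 2) <= Num.sqrt (\sum_g v g ^+ 2).
  move=> uv; rewrite ler_wsqrtr// ler_sum// => g _.
  have /andP[u0 uvg] := uv g.
  by rewrite ler_sqr ?nnegrE// (le_trans u0).
rewrite !sumC//; apply/andP; split; apply: le_sq => g.
  by rewrite mulr_ge0 ?mdist_ge0//=; have /andP[] := fab (to x g) (to y g).
by rewrite normr_ge0 /=; have /andP[] := fab (to x g) (to y g).
Qed.

End EquivariantLift.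

(** * Embedding the orbit space *)

Section OrbitRepresentative.
Context {R : realType} {G : finGroupType} {X : metricType R}.
Context {to : {action G &-> X}}.
Variable hto : isometric_action to.

Definition orbit_of (x : X) : orbit_space hto :=
  exist _ (range (to x)) (ex_intro _ x erefl).

Lemma orbit_ofP x p : sval (orbit_of x) p <-> exists g, p = to x g.
Proof. by split=> [[g _ <-]|[g ->]]; [exists g|exists g]. Qed.

Definition orbit_repr (A : orbit_space hto) : X := projT1 (cid (svalP A)).

Lemma orbit_reprP A p : sval A p <-> exists g, p = to (orbit_repr A) g.
Proof.
rewrite {1}(projT2 (cid (svalP A))) -/(orbit_repr A).
by split=> [[g _ <-]|[g ->]]; [exists g|exists g].
Qed.

End OrbitRepresentative.

Section QuotientFiniteEmbedding.
Context {R : realType} {G : finGroupType} {X : metricType R}.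
Context {to : {action G &-> X}}.
Variable hto : isometric_action to.
Variables (H : completeNormedModType R) (f : X -> H) (a b r : R).
Hypotheses (hH : is_hilbert H) (a_gt0 : 0 < a) (b_ge0 : 0 <= b).
Hypothesis fab : forall x y, a * mdist x y <= `|f x - f y| <= b * mdist x y.
Hypothesis contortion_r : (contortion R G < r%:E)%E.

Let gamma : R := Num.sqrt #|G|%:R.

Let gamma_gt0 : 0 < gamma.
Proof.
by rewrite sqrtr_gt0 ltr0n; apply/card_gt0P; exists 1%g.
Qed.

Lemma quotient_finite_lift (s : seq (orbit_space hto)) :
  exists n (phi : orbit_space hto -> orbit_space (orthogonal_isometric
      (@regular_multiple_orthogonal R G n))),
    {in s &, forall A B, gamma * a * mdist A B <= mdist (phi A) (phi B) <=
                         gamma * b * mdist A B}.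
Proof.
(* All points of the orbits in [s], so that the lift is controlled at every representative. *)
pose L := [seq to (orbit_repr A) g | A <- s, g <- enum G].
have [n [F [Fact FL]]] := equivariant_lift hto hH (ltW a_gt0) b_ge0 fab L.
pose ho := orthogonal_isometric (@regular_multiple_orthogonal R G n).
pose phi (A : orbit_space hto) := orbit_of ho (F (orbit_repr A)).
have phi_in (A : orbit_space hto) p : sval A p -> sval (phi A) (F p).
  by move=> /orbit_reprP[g ->]; apply/(orbit_ofP ho); exists g; rewrite Fact.
have inL A p g : A \in s -> sval A p -> to p g \in L.
  move=> As /orbit_reprP[h ->]; rewrite -act_mul.
  by apply: allpairs_f; rewrite ?mem_enum.
exists n, phi => A B As Bs; apply/andP; split.
  (* By equivariance, a closest pair in the target orbits is the image of points of A and B, whose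
     distance is at least that of A and B. *)
  have [u [v [uA vB duv]]] := orbit_dist_attained (phi A) (phi B).
  have -> : mdist (phi A) (phi B) = mdist u v := duv.
  have [g ->] := (orbit_ofP ho _ u).1 uA.
  have [h ->] := (orbit_ofP ho _ v).1 vB.
  rewrite !Fact.
  have Ag : sval A (to (orbit_repr A) g) by apply/orbit_reprP; exists g.
  have Bh : sval B (to (orbit_repr B) h) by apply/orbit_reprP; exists h.
  have /andP[+ _] := FL _ _ (fun g' => inL _ _ g' As Ag)
    (fun g' => inL _ _ g' Bs Bh).
  apply: le_trans; rewrite ler_pM2l ?mulr_gt0//.
  exact: orbit_dist_le.
(* Conversely, the image of a closest pair bounds the target distance from above. *)
have [p [q [Ap Bq dpq]]] := orbit_dist_attained A B.
have -> : mdist A B = mdist p q := dpq.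
have /andP[_] := FL _ _ (fun g' => inL _ _ g' As Ap)
  (fun g' => inL _ _ g' Bs Bq).
apply: le_trans; apply: orbit_dist_le; exact: phi_in.
Qed.

Lemma quotient_finite_embedding (s : seq (orbit_space hto)) :
  exists (H' : completeNormedModType R) (h : orbit_space hto -> H'),
    is_hilbert H' /\ {in s &, forall A B,
      mdist A B <= `|h A - h B| <= r * (b / a) * mdist A B}.
Proof.
have [n [phi phis]] := quotient_finite_lift s.
pose V := orbit_space (orthogonal_isometric
  (@regular_multiple_orthogonal R G n)).
rewrite -/V in phi phis.
have ga0 : 0 < gamma * a by rewrite mulr_gt0.
(* On a one-point quotient [c2] is 1 by convention and supplies no map; but then the lower bound
   makes all distances within [s] vanish, and a constant map works. *)
have [Vtriv|/existsNP[u /existsNP[v uv]]] := pselect (forall u v : V, u = v).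
  exists H, (fun=> 0); split => // A B As Bs.
  have /andP[+ _] := phis A B As Bs.
  rewrite (Vtriv (phi A) (phi B)) mdistxx pmulr_rle0// => AB0.
  have -> : mdist A B = 0 by apply/eqP; rewrite eq_le AB0 mdist_ge0.
  by rewrite subrr normr0 mulr0 lexx.
have c2V : (c2 V < r%:E)%E.
  apply: le_lt_trans contortion_r; apply: ereal_sup_ubound.
  by exists _, (regular_multiple R G n), (@regular_multiple_orthogonal R G n).
have [H' [psi [[a' b'] /= [hH' a'0 b'a' psiP]]]] := c2_lt uv c2V.
(* Normalises the lower constant of the composite to 1; the factor [gamma] then cancels from the
   upper one. *)
pose c := (a' * (gamma * a))^-1.
have c0 : 0 < c by rewrite invr_gt0 mulr_gt0.
have b'0 : 0 <= b'.
  have d0 : 0 < mdist u v by rewrite mdist_gt0; exact/eqP.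
  have /andP[_ l2] := psiP u v.
  by rewrite -(pmulr_lge0 _ d0) (le_trans _ l2).
exists H', (fun A => c *: psi (phi A)); split => // A B As Bs.
rewrite -scalerBr normrZ gtr0_norm//.
have /andP[p1 p2] := psiP (phi A) (phi B).
have /andP[q1 q2] := phis A B As Bs.
apply/andP; split.
  rewrite -ler_pdivrMl// invrK (le_trans _ p1)// -mulrA.
  by rewrite ler_pM2l.
rewrite -ler_pdivlMl// (le_trans p2)//.
apply: (@le_trans _ _ (b' * (gamma * b * mdist A B))).
  by rewrite ler_wpM2l.
have -> : c^-1 * (r * (b / a) * mdist A B) =
    r * a' * (gamma * b * mdist A B).
  by rewrite /c invrK; field; rewrite gt_eqF.
by rewrite ler_wpM2r ?(ltW b'a')// !mulr_ge0 ?mdist_ge0// ltW.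
Qed.

End QuotientFiniteEmbedding.

(** The zero-dimensional representation is a witness. The bound keeps the product in the theorem
    away from 0 times infinity. *)
Lemma contortion_ge1 (R : realType) (G : finGroupType) :
  (1 <= contortion R G)%E.
Proof.
apply: (@le_trans _ _ (c2 (orbit_space (orthogonal_isometric
  (@regular_multiple_orthogonal R G 0))))); first exact: c2_ge1.
apply: ereal_sup_ubound.
by exists _, (regular_multiple R G 0), (@regular_multiple_orthogonal R G 0).
Qed.

Theorem theorem7 (R : realType) (G : finGroupType) (X : metricType R)
    (to : {action G &-> X}) (hto : isometric_action to) :
  (c2 (orbit_space hto) <= contortion R G * c2 X)%E.
Proof.
have U1 := contortion_ge1 R G; have c1 := c2_ge1 X.
have [Ytriv|/existsNP[A /existsNP[B AB]]] :=
    pselect (forall A B : orbit_space hto, A = B).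
  rewrite {1}/c2 asboolT// -[leLHS]mule1.
  by rewrite lee_pmul.
(* Two distinct orbits give two distinct points of X, so [c2 X] is a genuine infimum over maps. *)
have ABrepr : orbit_repr A <> orbit_repr B.
  move=> e; apply: AB; apply: (@orbit_eq _ _ _ _ _ _ _ (orbit_repr A)).
    by apply/orbit_reprP; exists 1%g; rewrite act_id.
  by apply/orbit_reprP; exists 1%g; rewrite act_id.
case UE : (contortion R G) => [u||]; last by rewrite UE in U1.
  2: by rewrite gt0_mulye ?leey// (lt_le_trans _ c1).
case cE : (c2 X) => [c||]; last by rewrite cE in c1.
  2: by rewrite -UE gt0_muley ?leey// (lt_le_trans _ U1).
rewrite UE cE !lee_fin in U1 c1.
have u0 : 0 < u by rewrite (lt_le_trans _ U1).
have c0 : 0 < c by rewrite (lt_le_trans _ c1).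
apply/lee_addgt0Pr => e e0.
(* As d <= 1, (u + d)(c + d) = u c + d (u + c + d) <= u c + d (u + c + 1) <= u c + e. *)
pose d := Num.min 1 (e / (u + c + 1)).
have d0 : 0 < d by rewrite lt_min ltr01 divr_gt0// !addr_gt0.
have d1 : d <= 1 by rewrite ge_min lexx.
have de : d * (u + c + 1) <= e.
  by rewrite -ler_pdivlMr ?addr_gt0// ge_min lexx orbT.
have udcd : (u + d) * (c + d) <= u * c + e by nra.
have [H [f [[b' b] /= [hH b'0 bb' fb]]]] : exists (H : completeNormedModType R)
    (f : X -> H) (p : R * R), [/\ is_hilbert H, 0 < p.1, p.2 < (c + d) * p.1 &
    forall x y, p.1 * mdist x y <= `|f x - f y| <= p.2 * mdist x y].
  by apply: (c2_lt ABrepr); rewrite cE lte_fin ltrDl.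
have b0 : 0 <= b.
  have m0 : 0 < mdist (orbit_repr A) (orbit_repr B).
    by rewrite mdist_gt0; exact/eqP.
  have /andP[_ l2] := fb (orbit_repr A) (orbit_repr B).
  by rewrite -(pmulr_lge0 _ m0) (le_trans _ l2).
have U_lt : (contortion R G < (u + d)%:E)%E by rewrite UE lte_fin ltrDl.
apply: (@le_trans _ _ ((u + d) * (b / b'))%:E).
  apply: c2_le AB _; apply: (hilbert_embedding_finitary A) => s.
  exact: (quotient_finite_embedding hH b'0 b0 fb U_lt).
rewrite -EFinM -EFinD lee_fin (le_trans _ udcd)//.
rewrite ler_pM2l ?addr_gt0//.
by rewrite ler_pdivrMr// ltW.
Qed.
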